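(* Let $R$ be a commutative ring with identity, $I$ an ideal of $R$, $M$ a finitely generated faithful multiplication $R$-module and $N$ a submodule of $M$. Then: (1) $I$ is a quasi $J$-ideal of $R$ if and only if $IM$ is a quasi $J$-submodule of $M$. (2) $N$ is a quasi $J$-submodule of $M$ if and only if $(N:M)$ is a quasi $J$-ideal of $R$. (3) $N$ is a quasi $J$-submodule of $M$ if and only if $N=I'M$ for some quasi $J$-ideal $I'$ of $R$. (4) If $I$ is a quasi $J$-ideal of $R$ and $N$ is a quasi $J$-submodule of $M$, then $IN$ is a quasi $J$-submodule of $M$.
   Context: All rings are commutative with identity and all modules are unital. $J(R)$ is the Jacobson radical of $R$. For a submodule $N$ of an $R$-module $M$, $(N:M)=\{r\in R: rM\subseteq N\}$. $M$ is faithful if $(0:M)=0$; $M$ is a multiplication module if every submodule $N$ of $M$ has the form $IM$ for some ideal $I$ of $R$ (equivalently $N=(N:M)M$). A proper submodule $P$ of $M$ is prime if $rm\in P$ ($r\in R$, $m\in M$) implies $m\in P$ or $r\in(P:M)$. $M\text{-}rad(N)$ is the intersection of all prime submodules of $M$ containing $N$ (an empty intersection being $M$). A proper submodule $N$ of $M$ is a quasi $J$-submodule if whenever $r\in R$, $m\in M$ with $rm\in N$ and $r\notin (J(R)M:M)$, then $m\in M\text{-}rad(N)$. A proper ideal $I$ of $R$ is a $J$-ideal if whenever $a,b\in R$ with $ab\in I$ and $a\notin J(R)$, then $b\in I$. A proper ideal $I$ of $R$ is a quasi $J$-ideal if its radical $\sqrt I$ is a $J$-ideal. *)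

(* Defs.v *)
From mathcomp Require Import all_boot all_algebra.
From mathcomp Require Import boolp classical_sets.

Set Implicit Arguments.
Unset Strict Implicit.
Unset Printing Implicit Defensive.

Import GRing.Theory.
Local Open Scope ring_scope.
Local Open Scope classical_set_scope.

(* Ideals and submodules are arbitrary [set]s, without any decidability
   assumption; rings are [comPzRingType]s, so that the zero ring is allowed. *)

Definition is_submodule (R : comPzRingType) (M : lmodType R) (N : set M) : Prop :=
  submod_closed [in N].

Definition is_ideal (R : comPzRingType) (I : set R) : Prop :=
  @is_submodule R R^o I.

Definition is_proper_submodule (R : comPzRingType) (M : lmodType R)
    (N : set M) : Prop :=
  is_submodule N /\ N <> setT.

Definition is_proper_ideal (R : comPzRingType) (I : set R) : Prop :=
  is_ideal I /\ I <> setT.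

Definition is_maximal_ideal (R : comPzRingType) (I : set R) : Prop :=
  is_proper_ideal I /\
  forall I' : set R, is_proper_ideal I' -> I `<=` I' -> I' = I.

Definition jacobson (R : comPzRingType) : set R :=
  \bigcap_(I in [set I : set R | is_maximal_ideal I]) I.
Arguments jacobson R : clear implicits.

Definition ideal_radical (R : comPzRingType) (I : set R) : set R :=
  [set a | exists n : nat, I (a ^+ n)].

(* The submodule IN: finite sums of products, not just products. *)
Definition ideal_smul (R : comPzRingType) (M : lmodType R)
    (I : set R) (N : set M) : set M :=
  [set x | exists (n : nat) (a : 'I_n -> R) (m : 'I_n -> M),
      [/\ forall i, I (a i), forall i, N (m i)
        & x = \sum_(i < n) a i *: m i]].

(* (N : M) *)
Definition colon (R : comPzRingType) (M : lmodType R) (N : set M) : set R :=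
  [set r | forall m : M, N (r *: m)].

Definition faithful_module (R : comPzRingType) (M : lmodType R) : Prop :=
  colon [set (0 : M)] = [set (0 : R)].

Definition fg_module (R : comPzRingType) (M : lmodType R) : Prop :=
  exists (n : nat) (g : 'I_n -> M),
    forall x : M, exists a : 'I_n -> R, x = \sum_(i < n) a i *: g i.

Definition multiplication_module (R : comPzRingType) (M : lmodType R) : Prop :=
  forall N : set M, is_submodule N ->
    exists2 I : set R, is_ideal I & N = ideal_smul I [set: M].

Definition prime_submodule (R : comPzRingType) (M : lmodType R)
    (P : set M) : Prop :=
  is_proper_submodule P /\
  forall (r : R) (m : M), P (r *: m) -> P m \/ colon P r.

Definition module_radical (R : comPzRingType) (M : lmodType R)
    (N : set M) : set M :=
  \bigcap_(P in [set P : set M | prime_submodule P /\ N `<=` P]) P.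

Definition quasi_J_submodule (R : comPzRingType) (M : lmodType R)
    (N : set M) : Prop :=
  is_proper_submodule N /\
  forall (r : R) (m : M), N (r *: m) ->
    ~ colon (ideal_smul (jacobson R) [set: M]) r -> module_radical N m.

Definition J_ideal (R : comPzRingType) (I : set R) : Prop :=
  is_proper_ideal I /\
  forall a b : R, I (a * b) -> ~ jacobson R a -> I b.

Definition quasi_J_ideal (R : comPzRingType) (I : set R) : Prop :=
  is_proper_ideal I /\ J_ideal (ideal_radical I).

(* Main.v *)
(* A finitely generated faithful multiplication module satisfies (IM : M) = I,
   so N |-> (N : M) and I |-> IM are mutually inverse. An element m is handled
   through the ideal (Rm : M), since Rm = (Rm : M)M: from rm in IM one gets
   r(Rm : M) in I, which transports the condition from I to IM. Conversely pM is
   a prime submodule for every prime ideal p, hence (M-rad(IM) : M) is contained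
   in the radical of I; and J(R), being an intersection of primes, is radical.
   For (4), K = (IN : M) lies between I(N : M) and the intersection of I and
   (N : M), so the J-property passes from their radicals to that of K. *)
Require Import Defs.
From mathcomp Require Import all_boot all_algebra.
From mathcomp Require Import boolp classical_sets.
From mathcomp Require Import ring.

Set Implicit Arguments.
Unset Strict Implicit.
Unset Printing Implicit Defensive.

Import GRing.Theory.
Local Open Scope ring_scope.
Local Open Scope classical_set_scope.

(** * Submodules and products [I N] *)

Section Submodules.
Variables (R : comPzRingType) (M : lmodType R).
Implicit Types (N S P : set M) (I : set R).

Lemma submoduleP N :
  is_submodule N <->
  N 0 /\ forall (a : R) (x y : M), N x -> N y -> N (a *: x + y).
Proof.
split=> [[h0 hD]|[h0 hD]]; split.
- by move: h0; rewrite inE.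
- move=> a x y Nx Ny; suff : a *: x + y \in [in N] by rewrite inE.
  by apply: hD; rewrite inE.
- by rewrite inE.
- move=> a x y; rewrite !inE; exact: hD.
Qed.

Lemma submodule0 N : is_submodule N -> N 0.
Proof. by case/submoduleP. Qed.

Lemma submoduleZ N (a : R) (x : M) : is_submodule N -> N x -> N (a *: x).
Proof. by case/submoduleP=> h0 hD Nx; rewrite -[_ *: _]addr0; apply: hD. Qed.

Lemma submoduleD N (x y : M) : is_submodule N -> N x -> N y -> N (x + y).
Proof. by case/submoduleP=> h0 hD Nx Ny; rewrite -[x]scale1r; apply: hD. Qed.

Lemma submodule_sum N (J : Type) (s : seq J) (F : J -> M) :
  is_submodule N -> (forall j, N (F j)) -> N (\sum_(j <- s) F j).
Proof.
move=> hN hF; elim/big_ind: _ => [|x y|//]; first exact: submodule0.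
exact: submoduleD.
Qed.

Lemma ideal_smul_min I N S : is_submodule S ->
  (forall a m, I a -> N m -> S (a *: m)) -> ideal_smul I N `<=` S.
Proof.
move=> hS h x [n [a [m [Ia Nm ->]]]]; apply: submodule_sum => // i.
exact: h.
Qed.

Lemma ideal_smul_mem I N a m : I a -> N m -> ideal_smul I N (a *: m).
Proof.
move=> Ia Nm; exists 1%N, (fun=> a), (fun=> m); split=> //.
by rewrite big_ord1.
Qed.

End Submodules.

(** * Radicals, prime ideals, the Jacobson radical and Krull's theorem *)

Section Ideals.
Variable R : comPzRingType.
Implicit Types (I P : set R) (a b : R).

Lemma idealP I :
  is_ideal I <-> I 0 /\ forall a x y : R, I x -> I y -> I (a * x + y).
Proof. exact: (@submoduleP R R^o). Qed.

Lemma ideal0 I : is_ideal I -> I 0.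
Proof. exact: (@submodule0 R R^o). Qed.

Lemma idealMl I a b : is_ideal I -> I b -> I (a * b).
Proof. exact: (@submoduleZ R R^o). Qed.

Lemma idealMr I a b : is_ideal I -> I a -> I (a * b).
Proof. by rewrite mulrC; exact: idealMl. Qed.

Lemma idealD I a b : is_ideal I -> I a -> I b -> I (a + b).
Proof. exact: (@submoduleD R R^o). Qed.

Lemma ideal_sum I (J : Type) (s : seq J) (F : J -> R) :
  is_ideal I -> (forall j, I (F j)) -> I (\sum_(j <- s) F j).
Proof. exact: (@submodule_sum R R^o). Qed.

Lemma ideal1 I : is_ideal I -> I 1 -> I = setT.
Proof.
by move=> hI I1; apply/seteqP; split=> // x _; rewrite -[x]mulr1; apply: idealMl.
Qed.

Lemma idealX_le I a n m : is_ideal I -> (n <= m)%N -> I (a ^+ n) -> I (a ^+ m).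
Proof. by move=> hI nm Ia; rewrite -(subnK nm) exprD; apply: idealMl. Qed.

Lemma ideal_radical_sub I : I `<=` ideal_radical I.
Proof. by move=> a Ia; exists 1%N; rewrite expr1. Qed.

Lemma ideal_radical_ideal I : is_ideal I -> is_ideal (ideal_radical I).
Proof.
move=> hI; apply/idealP; split.
  by apply: ideal_radical_sub; exact: ideal0.
move=> a x y [n Ix] [m Iy]; exists (n + m)%N; rewrite exprDn.
apply: ideal_sum => // -[i /= _]; rewrite -mulr_natl; apply: idealMl => //.
(* The exponent [n + m] forces each binomial term to contain either [y ^+ m] or [x ^+ n]. *)
have [im|mi] := leqP m i.
  by apply: idealMl => //; apply: idealX_le Iy.
apply: idealMr => //; rewrite exprMn; apply: idealMl => //.
apply: (idealX_le hI _ Ix). by rewrite -addnBA ?leq_addr // ltnW.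
Qed.

Lemma ideal_radical1 I : ideal_radical I 1 -> I 1.
Proof. by case=> n; rewrite expr1n. Qed.

Lemma ideal_radical_proper I : is_proper_ideal I ->
  is_proper_ideal (ideal_radical I).
Proof.
case=> hI hT; split=> [|hr]; first exact: ideal_radical_ideal.
by apply: hT; apply: ideal1 => //; apply: ideal_radical1; rewrite hr.
Qed.

Definition prime_ideal P : Prop :=
  is_proper_ideal P /\ forall a b, P (a * b) -> P a \/ P b.

(** This is [P + R a] when [P] is an ideal. *)
Definition ideal_adjoin P a : set R := [set x | exists r, P (x - r * a)].

Lemma ideal_adjoin_ideal P a : is_ideal P -> is_ideal (ideal_adjoin P a).
Proof.
move=> hP; apply/idealP; split; first by exists 0; rewrite mul0r subr0; exact: ideal0.
move=> c x y [r Pr] [s Ps]; exists (c * r + s).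
have -> : c * x + y - (c * r + s) * a = c * (x - r * a) + (y - s * a) by ring.
by apply: idealD => //; apply: idealMl.
Qed.

Lemma ideal_adjoin_sub P a : P `<=` ideal_adjoin P a.
Proof. by move=> x Px; exists 0; rewrite mul0r subr0. Qed.

Lemma ideal_adjoin_mem P a : is_ideal P -> ideal_adjoin P a a.
Proof. by move=> hP; exists 1; rewrite mul1r subrr; exact: ideal0. Qed.

Lemma maximal_ideal_prime P : is_maximal_ideal P -> prime_ideal P.
Proof.
move=> [[hP PT] hmax]; split=> // a b Pab.
have adj := ideal_adjoin_ideal a hP.
have [aT|aNT] := pselect (ideal_adjoin P a = setT).
  have [r Pr] : ideal_adjoin P a 1 by rewrite aT.
  right; have -> : b = (1 - r * a) * b + r * (a * b) by ring.
  by apply: idealD => //; [apply: idealMr|apply: idealMl].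
left; rewrite -(hmax _ (conj adj aNT) (@ideal_adjoin_sub P a)).
exact: ideal_adjoin_mem.
Qed.

Lemma prime_idealX P a n : prime_ideal P -> P (a ^+ n) -> P a.
Proof.
move=> [[hP PT] hpr]; elim: n => [|n ih].
  by rewrite expr0 => P1; case: PT; apply: ideal1.
by rewrite exprS => /hpr[].
Qed.

Lemma jacobson_ideal : is_ideal (jacobson R).
Proof.
apply/idealP; split=> [P [[hP _] _]|a x y Jx Jy P Pm]; first exact: ideal0.
have hP : is_ideal P by case: Pm => -[].
by apply: idealD => //; [apply: idealMl => //; apply: Jx|apply: Jy].
Qed.

Lemma jacobson_radical a n : jacobson R (a ^+ n) -> jacobson R a.
Proof.
move=> Ja P Pm; apply: prime_idealX (Ja P Pm); exact: maximal_ideal_prime.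
Qed.

(** Zorn's lemma gives an ideal maximal among those containing [I] and avoiding all powers of [b];
    such an ideal is prime. *)
Lemma krull_prime I b : is_ideal I -> ~ ideal_radical I b ->
  exists P, [/\ prime_ideal P, I `<=` P & ~ P b].
Proof.
move=> hI Ib.
pose good P := [/\ is_ideal P, I `<=` P & forall n, ~ P (b ^+ n)].
have goodI : good I by split=> // n In; apply: Ib; exists n.
have [|A [gA mA]] := @Zorn_bigcup R [set A | A = set0 \/ good A].
  move=> F FP Ftot.
  have [[X0 [FX0 gX0]]|nF] := pselect (exists X, F X /\ good X); last first.
    left; apply/seteqP; split=> // x [X FX Xx].
    have [X0|gX] := FP _ FX; first by rewrite X0 in Xx.
    by case: nF; exists X.
  have gX X x : F X -> X x -> good X.
    by move=> FX Xx; case: (FP _ FX) => // X0'; rewrite X0' in Xx.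
  right; split.
  - apply/idealP; split.
      by exists X0 => //; apply: ideal0; case: gX0.
    move=> a x y [X FX Xx] [Y FY Yy].
    have hX : is_ideal X by case: (gX _ _ FX Xx).
    have hY : is_ideal Y by case: (gX _ _ FY Yy).
    have [XY|YX] := Ftot _ _ FX FY.
      by exists Y => //; apply: idealD => //; apply: idealMl => //; apply: XY.
    by exists X => //; apply: idealD => //; [apply: idealMl|apply: YX].
  - by move=> x Ix; exists X0 => //; case: gX0 => _ + _; apply.
  - by move=> n [X FX Xn]; case: (gX _ _ FX Xn) => _ _ /(_ n).
have {}gA : good A.
  case: gA => // A0; exfalso; apply: (mA I); last by right.
  rewrite A0; split=> [//|]; move/(_ 0); apply; exact: ideal0.
have [hA IA nA] := gA.
have meets a : ~ A a -> exists n, ideal_adjoin A a (b ^+ n).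
  move=> Aa; apply: contrapT => nn; apply: (mA (ideal_adjoin A a)).
    split=> [|h]; first exact: ideal_adjoin_sub.
    by apply: Aa; apply: h; exact: ideal_adjoin_mem.
  right; split; first exact: ideal_adjoin_ideal.
    by move=> x Ix; apply: ideal_adjoin_sub; apply: IA.
  by move=> n An; apply: nn; exists n.
exists A; split=> //; last by move=> Ab; apply: (nA 1%N); rewrite expr1.
split; first by split=> // AT; apply: (nA 0%N); rewrite AT.
(* If [x] and [y] lie outside [A], powers of [b] lie in [A + R x] and [A + R y]; their product lies
   in [A + R x y = A], a contradiction. *)
move=> x y Axy; apply: contrapT => /not_orP[/meets[n [r hr]] /meets[m [s hs]]].
apply: (nA (n + m)%N); rewrite exprD.
have -> : b ^+ n * b ^+ m = (b ^+ n - r * x) * b ^+ m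
   + (r * x * (b ^+ m - s * y) + (r * s) * (x * y)) by ring.
apply: idealD => //; first exact: idealMr.
by apply: idealD => //; apply: idealMl.
Qed.

End Ideals.

(** * Nakayama's lemma: [T M = M] forces [T = R] *)

Section Nakayama.
Variables (R : comPzRingType) (M : lmodType R) (T : set R).
Hypothesis hT : is_ideal T.
Hypothesis TM : ideal_smul T [set: M] = setT.

Fixpoint seq_span (s : seq M) : set M :=
  if s is g :: s' then [set x | exists a : R, seq_span s' (x - a *: g)]
  else [set 0].

Lemma seq_span_submodule s : is_submodule (seq_span s).
Proof.
elim: s => [|g s ih] /=; apply/submoduleP; split=> //=.
- by move=> a x y -> ->; rewrite scaler0 addr0.
- by exists 0; rewrite scale0r subr0; exact: submodule0.
move=> c x y [a ha] [b hb]; exists (c * a + b).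
have -> : c *: x + y - (c * a + b) *: g = c *: (x - a *: g) + (y - b *: g).
  by rewrite scalerDl scalerBr scalerA opprD addrACA.
by apply: submoduleD => //; apply: submoduleZ.
Qed.

(* Generators are eliminated one at a time: the multiplier [u], congruent to
   [1] modulo [T], moves [M] into the span of fewer and fewer of them. *)
Lemma nakayama_seq s u : T (1 - u) -> (forall x, seq_span s (u *: x)) ->
  exists2 v, T (1 - v) & forall x : M, v *: x = 0.
Proof.
elim: s u => [|g s ih] u Tu hu; first by exists u.
have hs := seq_span_submodule s.
(* [S] consists of the [x] with [u x] in [T g] modulo the span of [s]. It contains [T M = M], hence
   [g] itself. *)
pose S := [set x : M | exists2 a, T a & seq_span s (u *: x - a *: g)].
have hS : is_submodule S.
  apply/submoduleP; split.
    exists 0; first exact: ideal0.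
    by rewrite scaler0 scale0r subr0; exact: submodule0.
  move=> c x y [a Ta ha] [b Tb hb]; exists (c * a + b).
    by apply: idealD => //; apply: idealMl.
  have -> : u *: (c *: x + y) - (c * a + b) *: g =
      c *: (u *: x - a *: g) + (u *: y - b *: g).
    by rewrite scalerDl scalerDr scalerBr !scalerA opprD addrACA (mulrC u).
  by apply: submoduleD => //; apply: submoduleZ.
have Sg : S g.
  have : ideal_smul T [set: M] g by rewrite TM.
  apply: ideal_smul_min => // a m Ta _; have [c hc] := hu m.
  exists (a * c); first exact: idealMr.
  have -> : u *: (a *: m) - (a * c) *: g = a *: (u *: m - c *: g).
    by rewrite scalerBr !scalerA (mulrC u).
  exact: submoduleZ.
(* [u] sends [M] into the span of [g :: s], and [u - a] then sends [g] into the span of [s]. *)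
have [a Ta ha] := Sg; apply: (ih ((u - a) * u)).
  have -> : 1 - (u - a) * u = (1 + u) * (1 - u) + u * a by ring.
  by apply: idealD => //; apply: idealMl.
move=> x; have [c hc] := hu x.
have -> : ((u - a) * u) *: x =
    (u - a) *: (u *: x - c *: g) + c *: (u *: g - a *: g).
  by rewrite -scalerBl scalerBr !scalerA (mulrC c) subrK.
by apply: submoduleD => //; apply: submoduleZ.
Qed.

Lemma seq_span_sum n (g : 'I_n -> M) (a : 'I_n -> R) (s : seq 'I_n) :
  seq_span [seq g i | i <- s] (\sum_(i <- s) a i *: g i).
Proof.
elim: s => [|i s ih] /=; first by rewrite big_nil.
by exists (a i); rewrite big_cons addrAC subrr add0r.
Qed.

(** Starting from [u = 1], the elimination ends with [v] congruent to [1] modulo [T] and killing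
    [M]; faithfulness gives [v = 0]. *)
Lemma nakayama : fg_module M -> faithful_module M -> T 1.
Proof.
move=> [n [g hg]] hf.
have [||v Tv hv] := @nakayama_seq [seq g i | i <- index_enum 'I_n] 1.
- by rewrite subrr; exact: ideal0.
- by move=> x; rewrite scale1r; have [a ->] := hg x; exact: seq_span_sum.
have : colon [set (0 : M)] v by [].
by rewrite hf => v0; rewrite v0 subr0 in Tv.
Qed.

End Nakayama.

(** * Products, colon ideals and cyclic submodules *)

Lemma ideal_smul_submodule (R : comPzRingType) (M : lmodType R) (I : set R)
  (N : set M) : is_ideal I -> is_submodule (ideal_smul I N).
Proof.
move=> hI; apply/submoduleP; split.
  by exists 0%N, (fun=> 0), (fun=> 0); split=> [[]|[]|] //; rewrite big_ord0.
move=> c x y [n [a [u [Ia Nu ->]]]] [m [b [v [Ib Nv ->]]]].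
exists (n + m)%N,
  (fun k => match split k with inl i => c * a i | inr j => b j end),
  (fun k => match split k with inl i => u i | inr j => v j end).
split=> [k|k|]; [case: split => j //; exact: idealMl|by case: split|].
rewrite big_split_ord scaler_sumr; congr (_ + _); apply: eq_bigr => i _.
  by rewrite (unsplitK (inl _ i)) scalerA.
by rewrite (unsplitK (inr _ i)).
Qed.

Lemma colon_ideal (R : comPzRingType) (M : lmodType R) (N : set M) :
  is_submodule N -> is_ideal (colon N).
Proof.
move=> hN; apply/idealP; split=> [m|a x y Nx Ny m].
  by rewrite scale0r; exact: submodule0.
rewrite scalerDl -scalerA; apply: submoduleD => //; exact: submoduleZ.
Qed.

Lemma ideal_smul_setTT (R : comPzRingType) (M : lmodType R) :
  ideal_smul [set: R] [set: M] = setT.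
Proof.
by apply/seteqP; split=> // x _; rewrite -[x]scale1r; apply: ideal_smul_mem.
Qed.

Definition cyclic (R : comPzRingType) (M : lmodType R) (m : M) : set M :=
  [set x | exists c : R, x = c *: m].

Lemma cyclic_submodule (R : comPzRingType) (M : lmodType R) (m : M) :
  is_submodule (cyclic m).
Proof.
apply/submoduleP; split=> [|a x y [c ->] [d ->]].
  by exists 0; rewrite scale0r.
by exists (a * c + d); rewrite scalerDl scalerA.
Qed.

(** * Finitely generated faithful multiplication modules *)

Section MultiplicationModules.
Variables (R : comPzRingType) (M : lmodType R).
Hypothesis fgM : fg_module M.
Hypothesis faithM : faithful_module M.
Hypothesis mulM : multiplication_module M.
Implicit Types (I J : set R) (N P : set M) (m x : M).

Local Notation smulM I := (ideal_smul I [set: M]).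

Lemma colon_smul N : is_submodule N -> smulM (colon N) = N.
Proof.
move=> hN; apply/seteqP; split; first by apply: ideal_smul_min => // a m + _; apply.
(* Any [I] with [N = I M] is contained in [(N : M)]. *)
have [I hI NI] := mulM hN.
rewrite {1}NI; apply: ideal_smul_min.
  exact/ideal_smul_submodule/colon_ideal.
move=> a m Ia _; apply: ideal_smul_mem => // x.
by rewrite NI; apply: ideal_smul_mem.
Qed.

Lemma mem_colon_cyclic m : smulM (colon (cyclic m)) m.
Proof.
rewrite colon_smul; first by exists 1; rewrite scale1r.
exact: cyclic_submodule.
Qed.

(* Each [q] in [(R m : M)] satisfies [q ^+ 2 * r \in I], so the radical of
   [(I : r)] contains all the ideals [(R m : M)]; hence it multiplies [M] onto
   [M], and Nakayama puts [1] in it. *)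
Lemma colon_ideal_smul I : is_ideal I -> colon (smulM I) = I.
Proof.
move=> hI; apply/seteqP; split; last first.
  by move=> a Ia m; apply: ideal_smul_mem.
move=> r hr; pose K : set R := [set s | I (s * r)].
have hK : is_ideal K.
  apply/idealP; split; first by rewrite /K /= mul0r; exact: ideal0.
  move=> a x y Kx Ky; rewrite /K /= mulrDl -mulrA.
  by apply: idealD => //; apply: idealMl.
suff /ideal_radical1 : ideal_radical K 1 by rewrite /K /= mul1r.
apply: (nakayama (M := M)) => //; first exact: ideal_radical_ideal.
apply/seteqP; split=> // m _.
apply: (ideal_smul_min _ _ (mem_colon_cyclic m)).
  exact/ideal_smul_submodule/ideal_radical_ideal.
move=> q x hq _; apply: ideal_smul_mem => //; exists 2%N.
(* Since [r m] is in [I M] and [q M] in [R m], the element [q r m] lies in [I m]. *)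
have [a Ia qrm] : exists2 a, I a & q *: (r *: m) = a *: m.
  pose S := [set y | exists2 a, I a & q *: y = a *: m].
  have hS : is_submodule S.
    apply/submoduleP; split.
      by exists 0; [exact: ideal0|rewrite scaler0 scale0r].
    move=> c y z [a Ia ya] [b Ib zb]; exists (c * a + b).
      by apply: idealD => //; apply: idealMl.
    by rewrite scalerDr scalerDl -zb -scalerA -ya !scalerA (mulrC q).
  apply: (ideal_smul_min hS _ (hr m)) => b y Ib _.
  have [c hc] := hq y; exists (b * c); first exact: idealMr.
  by rewrite -scalerA -hc !scalerA mulrC.
(* [q r - a] kills [m] and [q] sends [M] into [R m], so the product annihilates [M]. *)
have : colon [set (0 : M)] (q * (q * r - a)).
  move=> y; have [c hc] := hq y.
  rewrite /= mulrC -scalerA hc scalerA mulrC -scalerA scalerBl -scalerA qrm.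
  by rewrite subrr scaler0.
rewrite faithM => /= h; rewrite /K /=.
have -> : q ^+ 2 * r = q * (q * r - a) + q * a by ring.
by rewrite h add0r; exact: idealMl.
Qed.

Lemma ideal_smul_proper I : is_ideal I ->
  is_proper_submodule (smulM I) <-> is_proper_ideal I.
Proof.
move=> hI; split=> -[_ hT]; split=> //.
- by move=> IT; apply: hT; rewrite IT ideal_smul_setTT.
- exact: ideal_smul_submodule.
- by move=> IT; apply: hT; rewrite -(colon_ideal_smul hI) IT; apply/seteqP; split.
Qed.

Lemma mul_colon_cyclic I r m q : is_ideal I -> smulM I (r *: m) ->
  colon (cyclic m) q -> I (r * q).
Proof.
move=> hI Irm hq; rewrite -(colon_ideal_smul hI) => x.
have [c hc] := hq x; rewrite -scalerA hc scalerA mulrC -scalerA.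
by apply: submoduleZ => //; exact: ideal_smul_submodule.
Qed.

Lemma mem_smul_of_colon_cyclic I m : is_ideal I ->
  colon (cyclic m) `<=` I -> smulM I m.
Proof.
move=> hI qI; apply: (ideal_smul_min _ _ (mem_colon_cyclic m)).
  exact: ideal_smul_submodule.
by move=> q x /qI Iq _; apply: ideal_smul_mem.
Qed.

(** If [r m] is in [P M], then [r (R m : M)] lies in [P]; when [r] is not in [P], this puts
    [(R m : M)] in [P] and so [m] in [P M]. *)
Lemma ideal_smul_prime (P : set R) : prime_ideal P -> prime_submodule (smulM P).
Proof.
move=> [pP hpr]; have hP : is_ideal P by case: pP.
split=> [|r m Prm]; first exact/ideal_smul_proper.
rewrite colon_ideal_smul //; have [Pr|nPr] := pselect (P r); first by right.
left; apply: mem_smul_of_colon_cyclic => // q hq.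
by have [] := hpr _ _ (mul_colon_cyclic hP Prm hq).
Qed.

Lemma radical_smul_sub I : smulM (ideal_radical I) `<=` module_radical (smulM I).
Proof.
move=> x hx P [[[hP PT] hpr] IP]; move: x hx.
apply: ideal_smul_min => // a m [n In] _.
have : colon P (a ^+ n) by move=> y; apply: IP; apply: ideal_smul_mem.
(* Primeness of [P] strips factors from [a ^+ n] until [a M] lies in [P]; exponent [0] would give
   [P = M]. *)
elim: n {In} => [|n ih] h.
  by case: PT; apply/seteqP; split=> // y _; rewrite -[y]scale1r; apply: h.
have [Pa|nPa] := pselect (colon P a); first exact: Pa.
apply: ih => y; have := h y; rewrite exprS -scalerA => /hpr[] //.
Qed.

(** For [c] outside the radical of [I], a prime [P] containing [I] but not [c] makes [P M] a prime
    submodule over [I M] whose colon [P] omits [c]. *)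
Lemma colon_module_radical I : is_ideal I ->
  colon (module_radical (smulM I)) `<=` ideal_radical I.
Proof.
move=> hI c hc; apply: contrapT => /(krull_prime hI)[P [pP IP nPc]]; apply: nPc.
have hP : is_ideal P by case: pP => -[].
rewrite -(colon_ideal_smul hP) => m; apply: (hc m); split.
  exact: ideal_smul_prime.
apply: ideal_smul_min; first exact: ideal_smul_submodule.
by move=> a x /IP Pa _; apply: ideal_smul_mem.
Qed.

Lemma quasi_J_ideal_smul I : is_ideal I ->
  quasi_J_ideal I <-> quasi_J_submodule (smulM I).
Proof.
move=> hI; rewrite /quasi_J_submodule (colon_ideal_smul (jacobson_ideal R)).
have hrI := ideal_radical_ideal hI; split.
  move=> [pI [_ hJ]]; split; first exact/ideal_smul_proper.
  (* It suffices that [(R m : M)] lies in the radical of [I]: each [q] in it has [r q] in [I] with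
     [r] outside the Jacobson radical. *)
  move=> r m Irm Jr; apply: radical_smul_sub.
  apply: mem_smul_of_colon_cyclic => // q hq; apply: hJ Jr.
  by apply: ideal_radical_sub; apply: mul_colon_cyclic Irm hq.
move=> [/(ideal_smul_proper hI) pI hJ]; split=> //.
split=> [|a b [n In] Ja]; first exact: ideal_radical_proper.
have [k hk] : ideal_radical I (b ^+ n).
  (* The submodule condition is used on [a ^+ n] and [b ^+ n *: m]; [a ^+ n] stays outside the
     Jacobson radical because that ideal is radical. *)
  apply: colon_module_radical => // m; apply: (hJ (a ^+ n)).
    by rewrite scalerA -exprMn; apply: ideal_smul_mem.
  by move/jacobson_radical.
by exists (n * k)%N; rewrite exprM.
Qed.

Lemma quasi_J_submodule_colon N : is_submodule N ->
  quasi_J_submodule N <-> quasi_J_ideal (colon N).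
Proof.
move=> hN; rewrite -{1}(colon_smul hN); split.
  by move/quasi_J_ideal_smul; apply; exact: colon_ideal.
by move/quasi_J_ideal_smul; apply; exact: colon_ideal.
Qed.

Lemma quasi_J_smul I N : is_ideal I -> is_submodule N ->
  quasi_J_ideal I -> quasi_J_submodule N -> quasi_J_submodule (ideal_smul I N).
Proof.
move=> hI hN [pI [prI hJI]] /(quasi_J_submodule_colon hN)[_ [_ hJN]].
have hIN : is_submodule (ideal_smul I N) by exact: ideal_smul_submodule.
have hK := colon_ideal hIN.
apply/quasi_J_submodule_colon => //.
have KI : colon (ideal_smul I N) `<=` I.
  move=> r hr; rewrite -(colon_ideal_smul hI) => m.
  apply: (ideal_smul_min _ _ (hr m)); first exact: ideal_smul_submodule.
  by move=> a x Ia _; apply: ideal_smul_mem.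
have KN : colon (ideal_smul I N) `<=` colon N.
  move=> r hr m; apply: (ideal_smul_min _ _ (hr m)) => // a x _.
  exact: submoduleZ.
have pK : is_proper_ideal (colon (ideal_smul I N)).
  split=> // KT; case: pI => _; apply; apply/seteqP; split=> // x _.
  by apply: KI; rewrite KT.
split=> //; split=> [|a b [n Kn] Ja]; first exact: ideal_radical_proper.
have [|k Ik] := hJI a b _ Ja; first by exists n; exact: KI.
have [|l Nl] := hJN a b _ Ja; first by exists n; exact: KN.
(* [b ^+ l] moves [M] into [N], and [b ^+ k] in [I] then moves [N] into [I N]. *)
by exists (k + l)%N => m; rewrite exprD -scalerA; apply: ideal_smul_mem.
Qed.

End MultiplicationModules.

Unset Implicit Arguments.

Theorem theorem2 (R : comPzRingType) (I : set R) (M : lmodType R) (N : set M)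
    (hI : is_ideal I)
    (hMfg : fg_module M) (hMfaithful : faithful_module M)
    (hMmul : multiplication_module M)
    (hN : is_submodule N) :
  (quasi_J_ideal I <-> quasi_J_submodule (ideal_smul I [set: M])) /\
  (quasi_J_submodule N <-> quasi_J_ideal (colon N)) /\
  (quasi_J_submodule N <->
     exists2 I' : set R, quasi_J_ideal I' & N = ideal_smul I' [set: M]) /\
  (quasi_J_ideal I -> quasi_J_submodule N ->
     quasi_J_submodule (ideal_smul I N)).
Proof.
split; first exact: quasi_J_ideal_smul.
split; first exact: quasi_J_submodule_colon.
split; last exact: quasi_J_smul.
split=> [/quasi_J_submodule_colon qN|[I' qI' ->]].
  by exists (colon N); [exact: qN|rewrite colon_smul].
by apply/quasi_J_ideal_smul => //; case: qI' => -[].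
Qed.
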